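(* Let $b\in\{2,3,\dots\}$ and $\ell\in\{1,\dots,b-1\}$, and let $\phi:\mathbb{R}\to\mathbb{R}$ be the 1-periodic function with $$\phi(t)=\begin{cases}t\,\frac{b}{2\ell}&\text{if }0\le t\le \ell/b,\\ (1-t)\,\frac{b}{2(b-\ell)}&\text{if }\ell/b\le t\le 1.\end{cases}$$ Suppose that $\alpha\in(-1,1)$ is such that $|\alpha|>1/b$ and $q:=-\log_{|\alpha|}b$ is an odd integer. Let $f(t)=\sum_{m=0}^\infty\alpha^m\phi(b^mt)$, $t\in[0,1]$, and let $Z:=\sum_{m=1}^\infty(\alpha b)^{-m}Y_m$, where $(Y_m)_{m\in\mathbb{N}}$ is the process associated with $\phi$ and $b$ as defined in the context. Then: (a) If $b$ is even and $\ell=b/2$, the signed $q^{\text{th}}$ variation of $f$ exists and vanishes identically, i.e. for all $t\in[0,1]$, $$\lim_{n\uparrow\infty}\sum_{k=0}^{\lfloor tb^n\rfloor}\big(f((k+1)b^{-n})-f(kb^{-n})\big)^q=0 .$$ (b) If $\alpha>0$, then the signed $q^{\text{th}}$ variation of $f$ exists and is given by $$\lim_{n\uparrow\infty}\sum_{k=0}^{\lfloor tb^n\rfloor}\big(f((k+1)b^{-n})-f(kb^{-n})\big)^q=t\cdot\mathbb{E}[Z^q],\qquad t\in[0,1].$$ Moreover, $\mathbb{E}[Z^q]$ is strictly positive if $\ell<b/2$ and strictly negative if $\ell>b/2$. (c) If $\alpha<0$ and $\ell\neq b/2$, then $$\lim_{n\uparrow\infty}(-1)^n\sum_{k=0}^{\lfloor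 tb^n\rfloor}\big(f((k+1)b^{-n})-f(kb^{-n})\big)^q=t\cdot\mathbb{E}[Z^q],\qquad t\in[0,1].$$ In particular, the signed $q^{\text{th}}$ variation of $f$ exists only along $(\mathbb{T}_{2n})_{n\in\mathbb{N}}$ or along $(\mathbb{T}_{2n+1})_{n\in\mathbb{N}}$ (i.e. it exists along each of these two subsequences, but not along the full sequence $(\mathbb{T}_n)_{n\in\mathbb{N}}$).
   Context: $\mathbb{N}=\{1,2,\dots\}$. Every function $f$ defined on $[0,1]$ is extended to $[0,\infty)$ by $f(t):=f(\min\{t,1\})$. $\mathbb{T}_n:=\{kb^{-n}:k=0,\dots,b^n\}$ denotes the $n$-th $b$-adic partition of $[0,1]$. For an odd integer $p$, the signed $p^{\text{th}}$ variation of $f$ (along $(\mathbb{T}_n)$) is the function $$t\mapsto\lim_{n\uparrow\infty}\sum_{k=0}^{\lfloor tb^n\rfloor}\big(f((k+1)b^{-n})-f(kb^{-n})\big)^p,\qquad t\in[0,1],$$ and it is said to exist if this limit exists for all $t\in[0,1]$; along $(\mathbb{T}_{2n})$ or $(\mathbb{T}_{2n+1})$ it is defined by taking the limit only over even or only over odd indices. Given $\phi$ and $b$, define $$\lambda_{m,k}:=\frac{\phi((k+1)b^{-m})-\phi(kb^{-m})}{b^{-m}},\qquad m\in\mathbb{N},\ k=0,\dots,b^m-1.$$ Let $(\Omega,\mathscr{F},\mathbb{P})$ be a probability space supporting an independent sequence $U_1,U_2,\dots$ of random variables, each uniformly distributed on $\{0,1,\dots,b-1\}$, and define $$R_m:=\sum_{i=1}^mU_ib^{i-1},\qquad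 Y_m:=\lambda_{m,R_m},\qquad m\in\mathbb{N}.$$ $\mathbb{E}$ denotes expectation with respect to $\mathbb{P}$. *)

(* Defs.v *)
From HB Require Import structures.
From mathcomp Require Import all_boot all_order all_algebra.
From mathcomp Require Import all_classical all_reals all_analysis.

Set Implicit Arguments.
Unset Strict Implicit.
Unset Printing Implicit Defensive.

Import Order.TTheory GRing.Theory Num.Theory.
Import numFieldNormedType.Exports.

Local Open Scope classical_set_scope.
Local Open Scope ring_scope.

Definition extend01 (R : realType) (f : R -> R) (t : R) : R := f (Num.min t 1).

Definition takagi_series (R : realType) (phi : R -> R) (b : nat) (alpha t : R)
    : R :=
  limn (fun N => \sum_(0 <= m < N) alpha ^+ m * phi (b%:R ^+ m * t)).

(* [Num.truncn] is the floor for nonnegative arguments; [t] ranges over [0, 1].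
   For t = 1 the last increment leaves [0, 1], hence [extend01]. *)
Definition variation_sum (R : realType) (b p : nat) (f : R -> R) (n : nat)
    (t : R) : R :=
  \sum_(0 <= k < (Num.truncn (t * b%:R ^+ n)).+1)
    (f (k.+1%:R / b%:R ^+ n) - f (k%:R / b%:R ^+ n)) ^+ p.

(* [s] enumerates the levels of the partitions: [id] for the full sequence,
   [fun n => n.*2] and [fun n => n.*2.+1] for the even and odd ones. *)
Definition signed_variation_exists_along (R : realType) (s : nat -> nat)
    (b p : nat) (f : R -> R) : Prop :=
  forall t : R, 0 <= t <= 1 -> cvgn (fun n => variation_sum b p f (s n) t).

Definition slope (R : realType) (phi : R -> R) (b m k : nat) : R :=
  (phi (k.+1%:R / b%:R ^+ m) - phi (k%:R / b%:R ^+ m)) / b%:R ^- m.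

(* Mutual independence of [X 0], [X 1], ...: product rule on every finite
   subfamily and all measurable events. *)
Definition independent_sequence (R : realType) (d : measure_display)
    (T : measurableType d) (P : probability T R) (d' : measure_display)
    (T' : measurableType d') (X : nat -> T -> T') : Prop :=
  forall (s : seq nat) (A : nat -> set T'), uniq s ->
    (forall i, measurable (A i)) ->
    P (\bigcap_(i in [set` s]) (X i @^-1` A i)) =
      (\prod_(i <- s) P (X i @^-1` A i))%E.

Definition uniform_below (R : realType) (d : measure_display)
    (T : measurableType d) (P : probability T R) (b : nat) (X : T -> nat)
    : Prop :=
  forall k : nat, (k < b)%N -> P (X @^-1` [set k]) = (b%:R^-1)%:E.

(* The random digits are indexed from 0: [U i] stands for the usual
   U_(i+1), so this is U_1 + U_2 b + ... + U_m b^(m-1). *)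
Definition digit_sum (T : Type) (b : nat) (U : nat -> T -> nat) (m : nat)
    (w : T) : nat :=
  (\sum_(i < m) U i w * b ^ i)%N.

Definition slope_process (R : realType) (T : Type) (phi : R -> R) (b : nat)
    (U : nat -> T -> nat) (m : nat) (w : T) : R :=
  slope phi b m (digit_sum b U m w).

Definition slope_series (R : realType) (T : Type) (phi : R -> R) (b : nat)
    (alpha : R) (U : nat -> T -> nat) (w : T) : R :=
  limn (fun N => \sum_(1 <= m < N)
    (alpha * b%:R) ^- m * slope_process phi b U m w).

(* Main.v *)
(* Put c = 1/(alpha b). Every slope of phi over a b-adic interval of level j+1
   depends only on the digit in position j of the index k, so the increment of f
   over [k b^-n, (k+1) b^-n] equals alpha^n W_n(k), where W_n(k) sums
   c^(j+1) y(digit j of k) over j < n. As alpha^q = sgn(alpha)/b, the variation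
   sum is sgn(alpha)^n times an average of W_n(k)^q over k <= t b^n. Since
   |W_n^q - W_M^q| <= C |c|^M and W_M is periodic modulo b^M, these averages
   converge to t a, where a is the limit of the averages of W_M^q over a full
   period; the same approximation applied to the uniform random digits gives
   E[Z^q] = a.
   The slopes are i.i.d. centred two-valued variables Y. For l < b/2 the even
   moments of Y are nonnegative, and so are the odd ones (strictly from order 3
   on), which for c > 0 propagates to the sum. For c < 0 the same holds for the
   pairs Y1 - |c| Y2. For l > b/2 replace Y by -Y, and for l = b/2 all odd
   moments vanish by symmetry. *)
Require Import Defs.
From HB Require Import structures.
From mathcomp Require Import all_boot all_order all_algebra.
From mathcomp Require Import ring lra zify.
From mathcomp Require Import all_classical all_reals all_analysis.
From mathcomp Require Import measurable_realfun.

Import Order.TTheory GRing.Theory Num.Theory.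
Import numFieldNormedType.Exports.

Local Open Scope classical_set_scope.
Local Open Scope ring_scope.

(** * Averages over blocks of indices and their moments *)

Lemma sum_nat_mul (V : nmodType) (F : nat -> V) (n N : nat) :
  \sum_(0 <= k < n * N) F k = \sum_(0 <= j < n) \sum_(0 <= i < N) F (j * N + i)%N.
Proof.
rewrite big_nat_mul; apply: eq_bigr => j _.
rewrite -[X in \sum_(X <= _ < _) _]add0n big_addn mulSn addnK.
by apply: eq_bigr => i _; rewrite addnC.
Qed.

(** Moment of [X] at a uniformly random index below [N]. Encoding uniform laws as finite averages
    keeps the algebra of moments free of a probability space. *)
Definition moment {R : realType} (N : nat) (X : nat -> R) (p : nat) : R :=
  (\sum_(0 <= k < N) X k ^+ p) / N%:R.

Lemma moment_ext (R : realType) (N : nat) (X Y : nat -> R) (p : nat) :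
  (forall i, (i < N)%N -> X i = Y i) -> moment N X p = moment N Y p.
Proof.
move=> XY; congr (_ / _); apply: eq_big_nat => i /andP[_ iN].
by rewrite XY.
Qed.

Lemma moment0 (R : realType) (N : nat) (X : nat -> R) :
  (0 < N)%N -> moment N X 0 = 1.
Proof.
move=> N0; rewrite /moment (eq_bigr (fun=> 1)) => [|i _]; last by rewrite expr0.
by rewrite sumr_const_nat subn0 divff// pnatr_eq0 -lt0n.
Qed.

Lemma momentZ (R : realType) (N : nat) (a : R) (X : nat -> R) (p : nat) :
  moment N (fun k => a * X k) p = a ^+ p * moment N X p.
Proof.
rewrite /moment mulrA mulr_sumr; congr (_ / _).
by apply: eq_bigr => k _; rewrite exprMn.
Qed.

Lemma moment_even_ge0 (R : realType) (N : nat) (X : nat -> R) (p : nat) :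
  ~~ odd p -> 0 <= moment N X p.
Proof.
by move=> p_even; rewrite divr_ge0// sumr_ge0// => k _; rewrite exprn_even_ge0.
Qed.

(** A uniform index [j * N + i] has independent uniform parts [i] and [j], so [Z] is a sum of
    independent variables: after the binomial theorem each double sum factors. *)
Lemma moment_add (R : realType) (N n : nat) (X V Z : nat -> R) (p : nat) :
  (forall i j, (i < N)%N -> (j < n)%N -> Z (j * N + i)%N = X i + V j) ->
  moment (n * N) Z p =
    \sum_(k < p.+1) moment N X (p - k) * moment n V k *+ 'C(p, k).
Proof.
move=> ZE; rewrite /moment sum_nat_mul.
under eq_big_nat => j /andP[_ jn].
  under eq_big_nat => i /andP[_ iN] do rewrite ZE// exprDn.
  rewrite exchange_big /=; over.
rewrite exchange_big /= mulr_suml; apply: eq_bigr => k _.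
set x := \sum_(0 <= i < N) _; set v := \sum_(0 <= j < n) V j ^+ k.
have -> : \sum_(0 <= j < n) \sum_(0 <= i < N)
    X i ^+ (p - k) * V j ^+ k *+ 'C(p, k) = x * v *+ 'C(p, k).
  rewrite mulr_sumr -sumrMnl; apply: eq_bigr => j _.
  by rewrite mulr_suml -sumrMnl.
rewrite natrM invfM -(mulr_natr (x * v)) -(mulr_natr (_ * _ * _)).
by move: x v (N%:R^-1) (n%:R^-1) ('C(p, k)%:R : R) => x v s t w; ring.
Qed.

(** * Base-[b] digits, digit series and the growth of their moments *)

Definition digit (b j k : nat) : nat := ((k %/ b ^ j) %% b)%N.

(** This is W_M(k). Only the lowest [M] digits of [k] enter, so it is defined for every [k] and
    periodic modulo [b ^ M]. *)
Definition digit_series {R : realType} (b : nat) (c : R) (y : nat -> R)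
    (M k : nat) : R :=
  \sum_(0 <= j < M) c ^+ j.+1 * y (digit b j k).

Lemma digit_mod (b M j k : nat) : (0 < b)%N -> (j < M)%N ->
  digit b j (k %% b ^ M) = digit b j k.
Proof.
move=> b0 jM; rewrite /digit [in RHS](divn_eq k (b ^ M)).
have -> : (b ^ M = b ^ (M - j.+1) * b * b ^ j)%N.
  by rewrite -expnSr -expnD; congr (_ ^ _)%N; lia.
by rewrite !mulnA divnMDl ?expn_gt0 ?b0// modnMDl.
Qed.

Lemma digit_series_mod (R : realType) (b M k : nat) (c : R) (y : nat -> R) :
  (0 < b)%N -> digit_series b c y M (k %% b ^ M) = digit_series b c y M k.
Proof.
move=> b0; apply: eq_big_nat => j /andP[_ jM].
by rewrite digit_mod.
Qed.

Lemma digit_seriesS (R : realType) (b M i u : nat) (c : R) (y : nat -> R) :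
  (0 < b)%N -> (i < b ^ M)%N -> (u < b)%N ->
  digit_series b c y M.+1 (u * b ^ M + i) =
    digit_series b c y M i + c ^+ M.+1 * y u.
Proof.
move=> b0 iM ub; rewrite /digit_series big_nat_recr//=; congr (_ + _ * y _).
- rewrite -/(digit_series _ _ _ _ _) -digit_series_mod//.
  by rewrite modnMDl digit_series_mod.
- by rewrite /digit divnMDl ?expn_gt0 ?b0// divn_small// addn0 modn_small.
Qed.

(* In the binomial expansion of a signed moment of X j.+1 every term is
   nonnegative, and one of them is the corresponding signed moment of X j. *)
Lemma moments_grow (R : realType) (n : nat) (N : nat -> nat)
    (X : nat -> nat -> R) (V d : nat -> R) (s : R) (p : nat) :
  (0 < n)%N -> N 0 = 1%N -> X 0%N 0%N = 0 -> (forall j, N j.+1 = (n * N j)%N) ->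
  (forall j w i, (w < n)%N -> (i < N j)%N ->
     X j.+1 (w * N j + i)%N = X j i + d j * V w) ->
  (forall j k, 0 <= (s * d j) ^+ k * moment n V k) ->
  forall j, (s * d 0) ^+ p * moment n V p <= s ^+ p * moment (N j.+1) (X j.+1) p.
Proof.
move=> n0 N0 X0 NS XS dV.
have N_gt0 j : (0 < N j)%N by elim: j => [|j IH]; rewrite ?N0// NS muln_gt0 n0.
have stepE j k : s ^+ k * moment (N j.+1) (X j.+1) k =
    \sum_(i < k.+1) (s ^+ (k - i) * moment (N j) (X j) (k - i)) *
      ((s * d j) ^+ i * moment n V i) *+ 'C(k, i).
  rewrite NS (@moment_add _ _ _ (X j) (fun w => d j * V w)); last first.
    by move=> i w iN wn; rewrite XS.
  rewrite mulr_sumr; apply: eq_bigr => i _; rewrite momentZ -mulrnAr.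
  have -> : s ^+ k = s ^+ (k - i) * s ^+ i.
    by rewrite -exprD subnK// -ltnS.
  by rewrite exprMn -[in RHS]mulrnAr -!mulrnAr; ring.
(* Every factor in the expansion is nonnegative, so signed moments of all orders stay nonnegative by
   induction on the level. *)
have X_ge0 j : forall k, 0 <= s ^+ k * moment (N j) (X j) k.
  elim: j => [|j IH] k.
    rewrite N0 /moment big_nat1 X0 divr1.
    by case: k => [|k]; rewrite ?expr0 ?mul1r// expr0n mulr0.
  rewrite stepE; apply: sumr_ge0 => i _.
  by rewrite mulrn_wge0// mulr_ge0.
elim=> [|j IH].
  rewrite NS N0 muln1 exprMn -mulrA -(momentZ _ _ (d 0)).
  rewrite (@moment_ext _ _ (X 1%N) (fun w => d 0 * V w))// => i ni.
  by have := XS 0%N i 0%N ni; rewrite N0 muln1 addn0 X0 add0r; apply.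
(* The term [i = 0] is the signed moment of the previous level, since moments of order 0 equal 1;
   the other terms only add to it. *)
apply: le_trans IH _; rewrite (stepE j.+1) big_ord_recl /= subn0 expr0 moment0//.
rewrite bin0 !mulr1 mulr1n lerDl; apply: sumr_ge0 => i _.
by rewrite mulrn_wge0// mulr_ge0.
Qed.

(** * Sign of the odd moments for two-valued slopes *)

(** Slope of the tent as a function of a digit: the first [l] digits lie on the rising side, the
    others on the falling side of slope [- z]. *)
Definition two_valued {R : realType} (l : nat) (x z : R) (u : nat) : R :=
  if (u < l)%N then x else - z.

Lemma sum_two_valued (R : realType) (l b : nat) (x z : R) (F : R -> R) :
  (l <= b)%N ->
  \sum_(0 <= u < b) F (two_valued l x z u) = l%:R * F x + (b - l)%:R * F (- z).
Proof.
move=> lb; rewrite (big_cat_nat _ lb)//=; congr (_ + _).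
- rewrite (eq_big_nat _ _ (F2 := fun=> F x)); last first.
    by move=> u /andP[_ ul]; rewrite /two_valued ul.
  by rewrite sumr_const_nat subn0 mulr_natl.
- rewrite (eq_big_nat _ _ (F2 := fun=> F (- z))); last first.
    by move=> u /andP[lu _]; rewrite /two_valued ltnNge lu.
  by rewrite sumr_const_nat mulr_natl.
Qed.

(** The centring [L * x = K * z] turns the odd moment of order p into L x (x^(p-1) - z^(p-1)), which
    is zero for p = 1 and positive for larger odd p. *)
Lemma two_valued_odd_moment (R : realType) (L K x z : R) (p : nat) :
  0 < L -> 0 < z -> z < x -> L * x = K * z -> odd p ->
  0 <= L * x ^+ p + K * (- z) ^+ p /\
  ((p != 1)%N -> 0 < L * x ^+ p + K * (- z) ^+ p).
Proof.
move=> L0 z0 zx LK; case: p => // p /= p_even.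
rewrite [(- z) ^+ _]exprNn -signr_odd /= p_even expr1 mulN1r mulrN.
have -> : L * x ^+ p.+1 - K * z ^+ p.+1 = L * x * (x ^+ p - z ^+ p).
  by rewrite mulrBr {2}LK !exprS !mulrA.
have x0 := lt_trans z0 zx.
have Lx0 : 0 < L * x by rewrite mulr_gt0.
case: p p_even => [|p] p_even.
  by rewrite !expr0 subrr mulr0 lexx.
have : 0 < L * x * (x ^+ p.+1 - z ^+ p.+1).
  by rewrite mulr_gt0// subr_gt0 ltrXn2r// ltW.
by move=> pos; split => //; exact: ltW.
Qed.

(* The odd moments of Y1 - r Y2, for independent Y1, Y2 taking the values x and
   -z with weights L and K. *)
Lemma two_step_odd_moment (R : realType) (L K x z r : R) (p : nat) :
  0 < L -> 0 < K -> 0 < z -> z < x -> 0 < r -> r < 1 ->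
  L * x = K * z -> odd p ->
  0 <= L * (L * (x - r * x) ^+ p + K * (- z - r * x) ^+ p)
     + K * (L * (x + r * z) ^+ p + K * (- z + r * z) ^+ p) /\
  ((p != 1)%N -> 0 < L * (L * (x - r * x) ^+ p + K * (- z - r * x) ^+ p)
     + K * (L * (x + r * z) ^+ p + K * (- z + r * z) ^+ p)).
Proof.
move=> L0 K0 z0 zx r0 r1 LK p_odd.
have x0 := lt_trans z0 zx.
have [->|p1] := eqVneq p 1%N.
  rewrite !expr1.
  have -> : L * (L * (x - r * x) + K * (- z - r * x))
     + K * (L * (x + r * z) + K * (- z + r * z)) =
     (1 - r) * (L + K) * (L * x - K * z) by ring.
  by rewrite LK subrr mulr0 lexx.
have N w : (- w) ^+ p = - w ^+ p.
  by rewrite exprNn -signr_odd p_odd expr1 mulN1r.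
have -> : - z - r * x = - (z + r * x) by ring.
have -> : - z + r * z = - ((1 - r) * z) by ring.
have -> : x - r * x = (1 - r) * x by ring.
rewrite !N !exprMn.
(* Equal outcomes carry the weights L^2 and K^2, mixed ones the weight L K. For the equal ones,
   factoring out (L x)^2 = (K z)^2 leaves x^(p-2) - z^(p-2). *)
have pos1 : 0 < L ^+ 2 * x ^+ p - K ^+ 2 * z ^+ p.
  case: p p_odd p1 {N} => [|[|p]]// p_odd _.
  have -> : L ^+ 2 * x ^+ p.+2 - K ^+ 2 * z ^+ p.+2 =
      (L * x) ^+ 2 * x ^+ p - (K * z) ^+ 2 * z ^+ p by rewrite !exprS; ring.
  rewrite LK -mulrBr mulr_gt0 ?exprn_gt0 ?mulr_gt0// subr_gt0.
  by rewrite ltrXn2r ?ltW//; case: p p_odd.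
have pos2 : 0 < (x + r * z) ^+ p - (z + r * x) ^+ p.
  rewrite subr_gt0 ltrXn2r//; first by case: p p_odd {p1 N pos1}.
  - by rewrite addr_ge0// ltW// mulr_gt0.
  - have : 0 < (1 - r) * (x - z) by rewrite mulr_gt0// subr_gt0.
    by lra.
have -> : L * (L * ((1 - r) ^+ p * x ^+ p) + K * - (z + r * x) ^+ p)
     + K * (L * (x + r * z) ^+ p + K * - ((1 - r) ^+ p * z ^+ p)) =
   (1 - r) ^+ p * (L ^+ 2 * x ^+ p - K ^+ 2 * z ^+ p)
   + L * K * ((x + r * z) ^+ p - (z + r * x) ^+ p) by ring.
have pos : 0 < (1 - r) ^+ p * (L ^+ 2 * x ^+ p - K ^+ 2 * z ^+ p)
   + L * K * ((x + r * z) ^+ p - (z + r * x) ^+ p).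
  by rewrite addr_gt0// !mulr_gt0// exprn_gt0// subr_gt0.
by split => //; exact: ltW.
Qed.

(** Two leading digits are read as a single digit [w] in base b^2, with [w %% b] in position [M] and
    [w %/ b] in position [M.+1]. *)
Lemma digit_seriesSS (R : realType) (b M i w : nat) (c : R) (y : nat -> R) :
  (0 < b)%N -> (i < b ^ M)%N -> (w < b * b)%N ->
  digit_series b c y M.+2 (w * b ^ M + i) =
    digit_series b c y M i + c ^+ M.+1 * (y (w %% b)%N + c * y (w %/ b)%N).
Proof.
move=> b0 iM wb.
have -> : (w * b ^ M + i = w %/ b * b ^ M.+1 + (w %% b * b ^ M + i))%N.
  by rewrite {1}(divn_eq w b) mulnDl -mulnA -expnS addnA.
have wb' : (w %% b < b)%N by rewrite ltn_pmod.
rewrite digit_seriesS ?digit_seriesS// ?ltn_divLR//.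
- by rewrite [c ^+ M.+2]exprSr mulrDr addrA mulrA.
- rewrite expnS (@leq_trans ((w %% b).+1 * b ^ M)%N)//.
    by rewrite mulSn addnC ltn_add2r.
  by rewrite leq_mul2r wb' orbT.
Qed.

(** The sign [s] reflects the variable, if necessary, so that its positive value is the larger one
    in modulus; this settles the odd orders, and the even ones need only [s ^+ k >= 0]. *)
Lemma signed_moment_two_valued (R : realType) (b l : nat) (x z s : R) :
  (0 < l < b)%N -> 0 < x -> 0 < z -> l%:R * x = (b - l)%:R * z ->
  s = 1 /\ z < x \/ s = -1 /\ x < z ->
  (forall k, 0 <= s ^+ k * moment b (two_valued l x z) k) /\
  (forall k, odd k -> (k != 1)%N -> 0 < s ^+ k * moment b (two_valued l x z) k).
Proof.
move=> /andP[l0 lb] x0 z0 LK sE.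
have b0 : 0 < b%:R :> R by rewrite ltr0n (ltn_trans l0).
have L0 : 0 < l%:R :> R by rewrite ltr0n.
have K0 : 0 < (b - l)%:R :> R by rewrite ltr0n subn_gt0.
suff main k : odd k -> 0 <= s ^+ k * moment b (two_valued l x z) k /\
    ((k != 1)%N -> 0 < s ^+ k * moment b (two_valued l x z) k).
  split=> k => [|/main[]//].
  have [/main[]//|k_even] := boolP (odd k).
  by rewrite mulr_ge0 ?moment_even_ge0// exprn_even_ge0.
move=> k_odd; rewrite -momentZ /moment.
rewrite (sum_two_valued _ _ _ _ _ (fun t => (s * t) ^+ k)) ?(ltnW lb)//.
suff [ge0 gt0] : 0 <= l%:R * (s * x) ^+ k + (b - l)%:R * (s * - z) ^+ k /\
    ((k != 1)%N -> 0 < l%:R * (s * x) ^+ k + (b - l)%:R * (s * - z) ^+ k).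
  by split=> [|k1]; [rewrite divr_ge0// ltW | rewrite divr_gt0// gt0].
case: sE => -[-> cmp].
  by rewrite !mul1r; exact: two_valued_odd_moment.
by rewrite !mulN1r opprK addrC; apply: two_valued_odd_moment.
Qed.

(** The same reflection for a pair of independent digits, coded as [w = j * b + i]. *)
Lemma signed_moment_two_step (R : realType) (b l : nat) (x z r s : R) :
  (0 < l < b)%N -> 0 < x -> 0 < z -> l%:R * x = (b - l)%:R * z ->
  0 < r < 1 -> s = 1 /\ z < x \/ s = -1 /\ x < z ->
  let V w := two_valued l x z (w %% b)%N - r * two_valued l x z (w %/ b)%N in
  (forall k, 0 <= s ^+ k * moment (b * b) V k) /\
  (forall k, odd k -> (k != 1)%N -> 0 < s ^+ k * moment (b * b) V k).
Proof.
move=> /andP[l0 lb] x0 z0 LK /andP[r0 r1] sE V.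
have b0 : 0 < (b * b)%:R :> R by rewrite ltr0n muln_gt0 (ltn_trans l0).
have L0 : 0 < l%:R :> R by rewrite ltr0n.
have K0 : 0 < (b - l)%:R :> R by rewrite ltr0n subn_gt0.
suff main k : odd k -> 0 <= s ^+ k * moment (b * b) V k /\
    ((k != 1)%N -> 0 < s ^+ k * moment (b * b) V k).
  split=> k => [|/main[]//].
  have [/main[]//|k_even] := boolP (odd k).
  by rewrite mulr_ge0 ?moment_even_ge0// exprn_even_ge0.
move=> k_odd; rewrite -momentZ /moment sum_nat_mul.
set y := two_valued l x z in V *.
have -> : \sum_(0 <= j < b) \sum_(0 <= i < b) (s * V (j * b + i)%N) ^+ k =
    \sum_(0 <= j < b) \sum_(0 <= i < b) (s * (y i - r * y j)) ^+ k.
  apply: eq_big_nat => j /andP[_ jb]; apply: eq_big_nat => i /andP[_ ib].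
  rewrite /V modnMDl modn_small// divnMDl ?divn_small ?addn0//.
  by rewrite (ltn_trans l0).
under eq_bigr => j _ do
  rewrite (sum_two_valued _ _ _ _ _ (fun t => (s * (t - r * y j)) ^+ k)) ?(ltnW lb)//.
rewrite (sum_two_valued _ _ _ _ _ (fun v => l%:R * (s * (x - r * v)) ^+ k +
  (b - l)%:R * (s * (- z - r * v)) ^+ k)) ?(ltnW lb)//.
set E := _ + _.
suff [ge0 gt0] : 0 <= E /\ ((k != 1)%N -> 0 < E).
  by split=> [|k1]; [rewrite divr_ge0// ltW | rewrite divr_gt0// gt0].
rewrite /E; case: sE => -[-> cmp].
  by rewrite !mul1r mulrN opprK; exact: two_step_odd_moment.
(* For [s = -1] the pairs (l, x) and (b - l, z) exchange their roles. *)
rewrite !mulN1r.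
have -> : - (x - r * x) = - x + r * x by ring.
have -> : - (- z - r * x) = z + r * x by ring.
have -> : - (x - r * - z) = - x - r * z by ring.
have -> : - (- z - r * - z) = z - r * z by ring.
by rewrite addrC ![l%:R * _ + (b - l)%:R * _]addrC; exact: two_step_odd_moment.
Qed.

(* For c < 0 the signs of the weights c ^+ j alternate, so a single digit does
   not act monotonically on the signed moments; two consecutive digits do. *)
Lemma digit_moment_sign (R : realType) (b l : nat) (x z c s : R) (q : nat) :
  (0 < l < b)%N -> 0 < x -> 0 < z -> l%:R * x = (b - l)%:R * z ->
  c != 0 -> -1 < c -> s = 1 /\ z < x \/ s = -1 /\ x < z ->
  odd q -> (q != 1)%N ->
  exists2 e : R, 0 < e & forall M, e <= Num.sg c * s *
    moment (b ^ M.*2.+2) (digit_series b c (two_valued l x z) M.*2.+2) q.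
Proof.
move=> lb x0 z0 LK c0 c1 sE q_odd q1.
have b0 : (0 < b)%N by move: lb => /andP[_]; exact: leq_trans.
set y := two_valued l x z.
have sq t : t = 1 \/ t = -1 -> t ^+ q = t :> R.
  by case=> ->; rewrite ?expr1n// -signr_odd q_odd expr1.
have s1 : s = 1 \/ s = -1 by case: sE => -[]; [left|right].
have [cneg|cpos|/eqP] := ltgtP c 0; last by rewrite (negbTE c0).
(* Here [r = - c]. The weight [c ^+ j.*2.+1] of each pair of digits is negative, so the sign to be
   propagated is [- s]. *)
- have [ge0 gt0] := @signed_moment_two_step _ b l x z (- c) s lb x0 z0 LK
    (ltac:(apply/andP; split; lra)) sE.
  set V := fun w => _ in ge0 gt0.
  have dE j : (- s) * c ^+ j.*2.+1 = (- c) ^+ j.*2.+1 * s.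
    rewrite [(- c) ^+ _]exprNn -signr_odd /= odd_double /= expr1.
    by ring.
  have dpos j : 0 < (- c) ^+ j.*2.+1 by rewrite exprn_gt0// oppr_gt0.
  (* The witness is the signed moment after the first pair of digits, where the weight is [c]; later
     pairs can only increase it. *)
  exists ((- s * c) ^+ q * moment (b * b) V q).
    by have := dE 0%N; rewrite double0 !expr1 => ->; rewrite exprMn -mulrA
      mulr_gt0 ?gt0// exprn_gt0// oppr_gt0.
  move=> M; have -> : Num.sg c * s = (- s) ^+ q.
    rewrite ltr0_sg// mulN1r sq//.
    by case: s1 => ->; [right|left; rewrite opprK].
  have := @moments_grow _ (b * b) (fun j => b ^ j.*2)%N
    (fun j => digit_series b c y j.*2) V (fun j => c ^+ j.*2.+1) (- s) q.
  apply => //.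
  + by rewrite muln_gt0 b0.
  + by rewrite /digit_series big_geq.
  + by move=> j; rewrite doubleS !expnS mulnA.
  + by move=> j w i wb ij; rewrite digit_seriesSS// /V mulNr opprK.
  + by move=> j k; rewrite dE exprMn -mulrA mulr_ge0// exprn_ge0// ltW.
(* For [c > 0] all weights are positive and digits can be added one at a time; the witness comes
   from the first digit. *)
- have [ge0 gt0] := @signed_moment_two_valued _ b l x z s lb x0 z0 LK sE.
  exists ((s * c) ^+ q * moment b y q).
    by rewrite mulrC exprMn mulrA [_ * s ^+ q]mulrC mulr_gt0 ?gt0 ?exprn_gt0.
  move=> M; have -> : Num.sg c * s = s ^+ q by rewrite gtr0_sg// mul1r sq.
  have := @moments_grow _ b (fun j => b ^ j)%N
    (fun j => digit_series b c y j) y (fun j => c ^+ j.+1) s q.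
  apply => //.
  + by rewrite /digit_series big_geq.
  + by move=> j; rewrite expnS.
  + by move=> j w i wb ij; rewrite digit_seriesS.
  + move=> j k; rewrite exprMn mulrAC.
    by rewrite mulr_ge0// ?exprn_ge0 ?ltW.
Qed.

(** For odd [q], one of [k] and [q - k] is odd in each binomial term. Then either the new digit,
    symmetric about 0, or the induction hypothesis contributes a zero factor. *)
Lemma digit_moment_symmetric (R : realType) (b l M : nat) (x c : R) (q : nat) :
  (0 < b)%N -> b = l.*2 -> odd q ->
  moment (b ^ M) (digit_series b c (two_valued l x x) M) q = 0.
Proof.
move=> b0 bl; elim: M q => [|M IH] q q_odd.
  rewrite expn0 /moment big_nat1 /digit_series big_geq// expr0n.
  by case: q q_odd => // q _; rewrite mul0r.
rewrite expnS (@moment_add _ _ _ (digit_series b c (two_valued l x x) M)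
  (fun u => c ^+ M.+1 * two_valued l x x u)); last first.
  by move=> i j iM jb; rewrite digit_seriesS.
rewrite big1// => k _; have kq : (k <= q)%N by rewrite -ltnS.
have [k_odd|k_even] := boolP (odd k).
- rewrite momentZ /moment (sum_two_valued _ _ _ _ _ (fun t => t ^+ k)).
    rewrite bl -addnn addKn [(- x) ^+ _]exprNn -signr_odd k_odd expr1.
    by rewrite mulN1r mulrN subrr mul0r !mulr0 mul0rn.
  by rewrite bl -addnn leq_addl.
- by rewrite IH ?mul0r ?mul0rn// oddB// q_odd (negbTE k_even).
Qed.

(** * Convergence of averages of almost periodic sequences *)

Lemma geometric_cauchy (R : realType) (u : nat -> R) (C r : R) :
  0 <= r < 1 -> (forall M n, (M <= n)%N -> `|u n - u M| <= C * r ^+ M) ->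
  exists2 a, u n @[n --> \oo] --> a & forall M, `|u M - a| <= C * r ^+ M.
Proof.
move=> /andP[r0 r1] uC.
have geo : C * r ^+ n @[n --> \oo] --> (0 : R).
  rewrite -[X in _ --> X](mulr0 C); apply: cvgM; first exact: cvg_cst.
  by apply: cvg_expr; rewrite ger0_norm.
have cu : cvgn u.
  apply/cauchy_cvgP; apply: cauchy_exP => e e0.
  have [M _ HM] := (cvgr0Pnorm_lt _).1 geo e e0.
  exists (u M); exists M => //= n Mn; rewrite /ball /= distrC.
  apply: le_lt_trans (uC _ _ Mn) _.
  by apply: le_lt_trans (ler_norm _) _; apply: HM => /=.
exists (limn u) => // M.
rewrite distrC; apply: (@cvgr_to_le _ \oo _ _ (fun n => `|u n - u M|)).
  by apply: cvg_norm; apply: cvgB => //; exact: cvg_cst.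
by exists M => // n /= Mn; exact: uC.
Qed.

Lemma sum_periodic (V : nmodType) (g : nat -> V) (P Q s : nat) :
  (0 < P)%N -> (forall k, g (k %% P)%N = g k) ->
  \sum_(0 <= k < Q * P + s) g k =
    (\sum_(0 <= k < P) g k) *+ Q + \sum_(0 <= k < s) g k.
Proof.
move=> P0 gP; rewrite (big_cat_nat _ (leq_addr s (Q * P)))//=; congr (_ + _).
  rewrite sum_nat_mul -[in RHS](subn0 Q) -sumr_const_nat.
  apply: eq_bigr => j _; apply: eq_bigr => i _.
  by rewrite -gP modnMDl gP.
rewrite -[X in \sum_(X <= _ < _) _]add0n big_addn addKn.
by apply: eq_bigr => i _; rewrite addnC -gP modnMDl gP.
Qed.

(** Full periods cancel exactly. The incomplete period and the share of the mean subtracted for it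
    are each at most [P%:R * C]. *)
Lemma periodic_average (R : realType) (g : nat -> R) (C : R) (P N : nat) :
  (0 < P)%N -> (forall k, g (k %% P)%N = g k) -> (forall k, `|g k| <= C) ->
  `|\sum_(0 <= k < N) g k - N%:R * ((\sum_(0 <= k < P) g k) / P%:R)|
    <= 2 * C * P%:R.
Proof.
move=> P0 gP gC; set S := \sum_(0 <= k < P) g k.
have P0' : 0 < P%:R :> R by rewrite ltr0n.
have SC s : `|\sum_(0 <= k < s) g k| <= s%:R * C.
  apply: le_trans (ler_norm_sum _ _ _) _.
  apply: le_trans (ler_sum (G := fun=> C) _ _) _ => [i _|]; first exact: gC.
  by rewrite sumr_const_nat subn0 mulr_natl.
rewrite (divn_eq N P) sum_periodic// -/S natrD natrM -(mulr_natl S).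
set Q := (N %/ P)%:R; set s := (N %% P)%N.
have sP : (s <= P)%N by rewrite ltnW// ltn_pmod.
have -> : Q * S + \sum_(0 <= k < s) g k - (Q * P%:R + s%:R) * (S / P%:R) =
    \sum_(0 <= k < s) g k - s%:R / P%:R * S.
  by field; rewrite gt_eqF.
have C0 : 0 <= C by apply: le_trans (gC 0%N).
have -> : 2 * C * P%:R = P%:R * C + P%:R * C by ring.
apply: le_trans (ler_normB _ _) _.
rewrite lerD//; first by apply: le_trans (SC _) _; rewrite ler_wpM2r// ler_nat.
rewrite normrM ger0_norm ?divr_ge0// -[leRHS]mul1r ler_pM ?divr_ge0//.
  by rewrite ler_pdivrMr// mul1r ler_nat.
exact: SC.
Qed.

Lemma cvg_geometric_half (R : realType) (r : R) :
  0 <= r < 1 -> r ^+ n./2 @[n --> \oo] --> (0 : R).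
Proof.
move=> /andP[r0 r1].
apply: (@cvg_comp _ _ _ (fun n => n./2) (GRing.exp r) _ \oo).
  by apply/cvgnyPge => A; exists A.*2 => // n /= An; rewrite geq_half_double.
by apply: cvg_expr; rewrite ger0_norm.
Qed.

(** The level [n] is compared with level M = n/2: then [g M] is close to [g n], while its period
    [b ^ M] is short compared with [b ^ n]. The condition [b%:R^-1 <= r] lets powers of [r] bound
    both kinds of error. *)
Lemma cvg_average (R : realType) (b : nat) (g : nat -> nat -> R) (C r : R) :
  (0 < b)%N -> b%:R^-1 <= r < 1 ->
  (forall M k, g M (k %% b ^ M)%N = g M k) -> (forall n k, `|g n k| <= C) ->
  (forall M n k, (M <= n)%N -> `|g n k - g M k| <= C * r ^+ M) ->
  exists2 a,
    (\sum_(0 <= k < b ^ M) g M k) / (b ^ M)%:R @[M --> \oo] --> a &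
  forall (t : R) (N : nat -> nat), 0 <= t <= 1 ->
    (forall n, `|(N n)%:R / (b ^ n)%:R - t| <= (b ^ n)%:R^-1) ->
    (\sum_(0 <= k < N n) g n k) / (b ^ n)%:R @[n --> \oo] --> t * a.
Proof.
move=> b0 /andP[br r1] gP gC gM.
have b0' : 0 < b%:R :> R by rewrite ltr0n.
have bn0 n : 0 < (b ^ n)%:R :> R by rewrite ltr0n expn_gt0 b0.
have r0 : 0 <= r by apply: le_trans br; rewrite invr_ge0.
have C0 : 0 <= C by apply: le_trans (gC 0%N 0%N).
pose A M := (\sum_(0 <= k < b ^ M) g M k) / (b ^ M)%:R.
have sum_dist M n N : (M <= n)%N ->
    `|\sum_(0 <= k < N) g n k - \sum_(0 <= k < N) g M k| <= N%:R * (C * r ^+ M).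
  move=> Mn; rewrite -sumrB; apply: le_trans (ler_norm_sum _ _ _) _.
  apply: le_trans (ler_sum (G := fun=> C * r ^+ M) _ _) _ => [i _|].
    exact: gM.
  by rewrite sumr_const_nat subn0 mulr_natl.
have [a Aa aP] : exists2 a, A n @[n --> \oo] --> a &
    forall M, `|A M - a| <= C * r ^+ M.
  apply: geometric_cauchy; first by rewrite r0.
  move=> M n Mn.
  (* The average over one period of [g M] is also its average over the [b ^ (n - M)] periods up to
     [b ^ n]. *)
  have -> : A M = (\sum_(0 <= k < b ^ n) g M k) / (b ^ n)%:R.
    have bnE : (b ^ n = b ^ (n - M) * b ^ M + 0)%N by rewrite addn0 -expnD subnK.
    rewrite [in RHS]bnE sum_periodic ?expn_gt0 ?b0// [X in _ + X]big_geq// addr0.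
    rewrite addn0 natrM -(mulr_natl (\sum_(0 <= k < b ^ M) _)) /A; field.
    by rewrite !gt_eqF.
  rewrite /A -mulrBl normrM normfV [`|_%:R|]ger0_norm// ler_pdivrMr//.
  by rewrite [leRHS]mulrC sum_dist.
exists a => // t N /andP[t0 t1] Nt.
have a2C : `|a| <= 2 * C.
  have A0 : `|A 0%N| <= C by rewrite /A expn0 big_nat1 divr1.
  have := aP 0%N; rewrite expr0 mulr1 => Aa0.
  have -> : a = A 0%N - (A 0%N - a) by ring.
  by apply: le_trans (ler_normB _ _) _; rewrite mulrDl mul1r lerD.
apply/subr_cvg0/norm_cvg0P.
(* The constant 8 collects four errors [e1] to [e4], each at most [2 * C * r ^+ M]. *)
have bound : (fun n => 8 * C * r ^+ n./2) @ \oo --> (0 : R).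
  rewrite -[X in _ --> X](mulr0 (8 * C)); apply: cvgM; first exact: cvg_cst.
  by apply: cvg_geometric_half; rewrite r0.
apply: squeeze_cvgr (@cvg_cst _ _ _ _ _) bound.
apply: nearW => n; apply/andP; split => //.
set M := n./2.
have Mn : (M <= n)%N by rewrite /M; lia.
have MnM : (M <= n - M)%N by rewrite /M; lia.
have rXle i j : (i <= j)%N -> r ^+ j <= r ^+ i.
  by move=> ij; rewrite ler_wiXn2l// ltW.
have bXle j : (b ^ j)%:R^-1 <= r ^+ j.
  by rewrite natrX -exprVn lerXn2r// ?nnegrE// invr_ge0.
have N2 : (N n)%:R <= 2 * (b ^ n)%:R :> R.
  rewrite -(ler_pdivrMr _ _ (bn0 n)).
  have := le_trans (ler_norm _) (Nt n).
  have : (b ^ n)%:R^-1 <= 1 :> R.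
    by rewrite invf_le1// ler1n expn_gt0 b0.
  by lra.
have e1 : `|(\sum_(0 <= k < N n) g n k - \sum_(0 <= k < N n) g M k) / (b ^ n)%:R|
    <= 2 * C * r ^+ M.
  rewrite normrM normfV [`|_%:R|]ger0_norm// ler_pdivrMr//.
  apply: le_trans (sum_dist _ _ _ Mn) _.
  have -> : 2 * C * r ^+ M * (b ^ n)%:R = 2 * (b ^ n)%:R * (C * r ^+ M) by ring.
  by rewrite ler_wpM2r// mulr_ge0// exprn_ge0.
have e2 : `|(\sum_(0 <= k < N n) g M k - (N n)%:R * A M) / (b ^ n)%:R|
    <= 2 * C * r ^+ M.
  rewrite normrM normfV [`|_%:R|]ger0_norm//.
  have := @periodic_average _ (g M) C (b ^ M) (N n).
  rewrite expn_gt0 b0 -/(A M) => /(_ isT (gP M) (gC M)) H.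
  apply: (@le_trans _ _ (2 * C * (b ^ M)%:R / (b ^ n)%:R)).
    by rewrite ler_wpM2r// invr_ge0 ltW.
  rewrite -[X in (b ^ X)%:R^-1](subnK Mn) expnD natrM invfM.
  have -> : 2 * C * (b ^ M)%:R * ((b ^ (n - M))%:R^-1 / (b ^ M)%:R) =
      2 * C * (b ^ (n - M))%:R^-1 by field; rewrite !gt_eqF.
  rewrite ler_wpM2l ?mulr_ge0//; apply: le_trans (bXle _) _.
  exact: rXle.
have e3 : `|(N n)%:R / (b ^ n)%:R * (A M - a)| <= 2 * C * r ^+ M.
  rewrite normrM [`|_ / _|]ger0_norm ?divr_ge0// -mulrA.
  by rewrite ler_pM ?divr_ge0// ler_pdivrMr.
have e4 : `|((N n)%:R / (b ^ n)%:R - t) * a| <= 2 * C * r ^+ M.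
  rewrite normrM mulrC ler_pM//; apply: le_trans (Nt n) _.
  by apply: le_trans (bXle n) _; exact: rXle.
have -> : (\sum_(0 <= k < N n) g n k) / (b ^ n)%:R - t * a =
   (\sum_(0 <= k < N n) g n k - \sum_(0 <= k < N n) g M k) / (b ^ n)%:R +
   (\sum_(0 <= k < N n) g M k - (N n)%:R * A M) / (b ^ n)%:R +
   (N n)%:R / (b ^ n)%:R * (A M - a) + ((N n)%:R / (b ^ n)%:R - t) * a by ring.
have -> : 8 * C * r ^+ M = 2 * C * r ^+ M + 2 * C * r ^+ M + 2 * C * r ^+ M
  + 2 * C * r ^+ M by ring.
apply: le_trans (ler_normD _ _) _; rewrite lerD//.
apply: le_trans (ler_normD _ _) _; rewrite lerD//.
by apply: le_trans (ler_normD _ _) _; rewrite lerD.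
Qed.

(** * Uniform bounds for digit series and their powers *)

Lemma normrXB_le (R : realType) (D x z : R) (p : nat) :
  `|x| <= D -> `|z| <= D ->
  `|x ^+ p - z ^+ p| <= p%:R * D ^+ p.-1 * `|x - z|.
Proof.
move=> xD zD; have D0 : 0 <= D by apply: le_trans xD.
rewrite subrXX normrM mulrC ler_wpM2r//.
apply: le_trans (ler_norm_sum _ _ _) _.
apply: le_trans (ler_sum (G := fun=> D ^+ p.-1) _ _) _ => [i _|]; last first.
  by rewrite sumr_const card_ord mulr_natl.
have -> : p.-1 = (p.-1 - i + i)%N by rewrite subnK//; case: p i => [[]|p [i]].
rewrite addnK normrM !normrX exprD.
by rewrite ler_pM// ?exprn_ge0// lerXn2r// ?nnegrE.
Qed.

Lemma geometric_tail_le (R : realType) (c B : R) (v : nat -> R) (M n : nat) :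
  `|c| < 1 -> (forall j, `|v j| <= B) -> (M <= n)%N ->
  `|\sum_(M <= j < n) c ^+ j.+1 * v j| <= B / (1 - `|c|) * `|c| ^+ M.
Proof.
move=> c1 vB Mn; set r := `|c|.
have B0 : 0 <= B by apply: le_trans (vB 0%N).
have r0 : 0 <= r by exact: normr_ge0.
have r1 : 0 < 1 - r by rewrite subr_gt0.
(* The exact geometric sum is subtracted at both ends so that the induction on [n] closes. *)
suff H : `|\sum_(M <= j < n) c ^+ j.+1 * v j| <=
    B / (1 - r) * (r ^+ M.+1 - r ^+ n.+1).
  apply: le_trans H _; apply: ler_wpM2l; first by rewrite divr_ge0// ltW.
  rewrite exprS lerBlDr ler_wpDr ?exprn_ge0//.
  by rewrite ler_piMl ?exprn_ge0// -/r ltW.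
elim: n Mn => [|n IH].
  by rewrite leqn0 => /eqP->; rewrite big_geq// normr0 subrr mulr0.
rewrite leq_eqVlt => /predU1P[->|].
  by rewrite big_geq// normr0 subrr mulr0.
rewrite ltnS => Mn; rewrite big_nat_recr//=.
apply: le_trans (ler_normD _ _) _.
have -> : B / (1 - r) * (r ^+ M.+1 - r ^+ n.+2) =
    B / (1 - r) * (r ^+ M.+1 - r ^+ n.+1) + r ^+ n.+1 * B.
  rewrite [r ^+ n.+2]exprS; field.
  by rewrite gt_eqF.
by rewrite lerD ?IH// normrM normrX ler_wpM2l ?exprn_ge0.
Qed.

Lemma digit_series_power_bounds (R : realType) (b q : nat) (c B : R) (y : nat -> R) :
  `|c| < 1 -> (0 < q)%N -> (forall u, `|y u| <= B) ->
  exists C, (forall M k, `|digit_series b c y M k ^+ q| <= C) /\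
    (forall M n k, (M <= n)%N ->
      `|digit_series b c y n k ^+ q - digit_series b c y M k ^+ q|
        <= C * `|c| ^+ M).
Proof.
move=> c1 q0 yB; set D := B / (1 - `|c|).
have dist M n k : (M <= n)%N ->
    `|digit_series b c y n k - digit_series b c y M k| <= D * `|c| ^+ M.
  move=> Mn; rewrite /digit_series (big_cat_nat _ Mn)//= addrC addrK.
  exact: geometric_tail_le.
have le_D n k : `|digit_series b c y n k| <= D.
  have := dist 0%N n k isT; rewrite expr0 mulr1.
  by rewrite /digit_series [X in _ - X]big_geq// subr0.
pose C := q%:R * D ^+ q.-1 * D.
have D0 : 0 <= D := le_trans (normr_ge0 _) (le_D 0%N 0%N).
have distq M n k : (M <= n)%N ->
    `|digit_series b c y n k ^+ q - digit_series b c y M k ^+ q|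
        <= C * `|c| ^+ M.
  move=> Mn; apply: le_trans (normrXB_le _ _ _ _ q (le_D n k) (le_D M k)) _.
  by rewrite /C -[leRHS]mulrA ler_wpM2l ?dist// mulr_ge0// exprn_ge0.
(* The uniform bound is the case [M = 0] of the distance bound: the empty series is 0, and so is its
   power because [q] is positive. *)
exists C; split=> // M k; have := distq 0%N M k isT.
rewrite expr0 mulr1; congr (`|_| <= _).
by rewrite [in X in _ - X]/digit_series big_geq// expr0n (gtn_eqF q0) subr0.
Qed.

(** * Slopes and increments of the function on the b-adic grid *)

Lemma periodic_nat (R : realType) (f : R -> R) (n : nat) :
  periodic f 1 -> f n%:R = f 0.
Proof. by move=> fper; rewrite -[n%:R]add0r (periodicn fper). Qed.

(** The kink [l / b] is the grid point [l * b ^ j] of level [j.+1], so no grid interval straddles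
    it. Modulo the period, the leading digit of the index decides the side. *)
Lemma slope_tent (R : realType) (b l : nat) (phi : R -> R) (j k : nat) :
  (0 < l < b)%N -> periodic phi 1 ->
  (forall t : R, 0 <= t <= l%:R / b%:R -> phi t = t * (b%:R / (2 * l%:R))) ->
  (forall t : R, l%:R / b%:R <= t <= 1 ->
     phi t = (1 - t) * (b%:R / (2 * (b%:R - l%:R)))) ->
  slope phi b j.+1 k = two_valued l (b%:R / (2 * l%:R))
    (b%:R / (2 * (b%:R - l%:R))) (digit b j k).
Proof.
move=> /andP[l0 lb] phi1 phi_left phi_right.
have b0 : (0 < b)%N by rewrite (ltn_trans l0).
have b0' : 0 < b%:R :> R by rewrite ltr0n.
have l0' : 0 < l%:R :> R by rewrite ltr0n.
have bl0 : 0 < b%:R - l%:R :> R by rewrite subr_gt0 ltr_nat.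
set P := (b ^ j.+1)%N; have P0 : (0 < P)%N by rewrite expn_gt0 b0.
have P0' : 0 < P%:R :> R by rewrite ltr0n.
set k0 := (k %% P)%N; have k0P : (k0 < P)%N by rewrite ltn_pmod.
have per i : phi ((k %/ P * P + i)%:R / P%:R) = phi (i%:R / P%:R).
  rewrite natrD natrM addrC mulrDl mulfK ?gt_eqF//.
  exact: (periodicn phi1).
have -> : digit b j k = (k0 %/ b ^ j)%N.
  rewrite -(@digit_mod b j.+1)// /digit modn_small//.
  by rewrite ltn_divLR ?expn_gt0 ?b0// -expnS.
rewrite /slope -!natrX -/P [k in phi (k.+1%:R / _)](divn_eq k P).
rewrite [k in _ - phi (k%:R / _)](divn_eq k P) -/k0 -addnS !per.
have lbE : l%:R / b%:R = (l * b ^ j)%:R / P%:R :> R.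
  by rewrite /P expnS !natrM; field; rewrite pnatr_eq0 -lt0n expn_gt0 b0 /= gt_eqF.
have left_E i : (i <= l * b ^ j)%N ->
    phi (i%:R / P%:R) = i%:R / P%:R * (b%:R / (2 * l%:R)).
  move=> il; rewrite phi_left// divr_ge0//= lbE.
  by rewrite ler_pM2r ?invr_gt0// ler_nat.
have right_E i : (l * b ^ j <= i)%N -> (i <= P)%N ->
    phi (i%:R / P%:R) = (1 - i%:R / P%:R) * (b%:R / (2 * (b%:R - l%:R))).
  move=> il iP; rewrite phi_right// lbE ler_pM2r ?invr_gt0// ler_nat il/=.
  by rewrite ler_pdivrMr// mul1r ler_nat.
rewrite /two_valued ltn_divLR ?expn_gt0 ?b0//.
case: ltnP => kl.
- rewrite !left_E// ?(ltnW kl)// -natr1.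
  by field; rewrite !gt_eqF.
- rewrite !right_E ?(leqW kl)// ?(ltnW k0P)// -natr1.
  by field; rewrite !gt_eqF.
Qed.

(** For [m >= n] the argument of [phi] is an integer, so these terms vanish and the partial sums are
    eventually constant. *)
Lemma takagi_grid (R : realType) (b : nat) (phi : R -> R) (alpha : R) (n k : nat) :
  (0 < b)%N -> periodic phi 1 -> phi 0 = 0 ->
  takagi_series phi b alpha (k%:R / b%:R ^+ n) =
    \sum_(0 <= m < n) alpha ^+ m * phi (k%:R / b%:R ^+ (n - m)).
Proof.
move=> b0 phi1 phi0; apply/cvg_lim => //.
have bn0 i : b%:R ^+ i != 0 :> R by rewrite expf_neq0// pnatr_eq0 -lt0n.
apply: cvg_near_cst; exists n => // N /= nN.
rewrite (big_cat_nat _ nN)//= [X in _ + X]big1_seq ?addr0; last first.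
  move=> m; rewrite /= mem_index_iota => /andP[nm _].
  have -> : b%:R ^+ m * (k%:R / b%:R ^+ n) = (b ^ (m - n) * k)%:R :> R.
    by rewrite natrM natrX -[in LHS](subnK nm) exprD; field; rewrite bn0.
  by rewrite periodic_nat// phi0 mulr0.
apply: eq_big_nat => m /andP[_ mn]; congr (_ * phi _).
rewrite -[in LHS](subnK (ltnW mn)) exprD; field.
by rewrite !bn0.
Qed.

Lemma takagi_increment (R : realType) (b : nat) (phi : R -> R) (y : nat -> R)
    (alpha : R) (n k : nat) :
  (0 < b)%N -> alpha != 0 -> periodic phi 1 -> phi 0 = 0 ->
  (forall j k, slope phi b j.+1 k = y (digit b j k)) ->
  takagi_series phi b alpha (k.+1%:R / b%:R ^+ n) -
    takagi_series phi b alpha (k%:R / b%:R ^+ n) =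
  alpha ^+ n * digit_series b (alpha * b%:R)^-1 y n k.
Proof.
move=> b0 a0 phi1 phi0 slopeE; rewrite !takagi_grid//.
have b0' : b%:R != 0 :> R by rewrite pnatr_eq0 -lt0n.
(* Reversing the sum pairs alpha^(n-1-j) with a slope of level j+1, and alpha^(n-1-j) b^-(j+1) =
   alpha^n (alpha b)^-(j+1). *)
rewrite -sumrB big_nat_rev /= mulr_sumr; apply: eq_big_nat => j /andP[_ jn].
rewrite add0n subKn// -mulrBr -slopeE /slope -[in RHS](subnK jn) exprD.
rewrite exprVn exprMn; field.
by rewrite !expf_neq0.
Qed.

Lemma variation_sum_takagi (R : realType) (b q : nat) (phi : R -> R)
    (y : nat -> R) (alpha : R) :
  (0 < b)%N -> alpha != 0 -> periodic phi 1 -> phi 0 = 0 -> (0 < q)%N ->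
  (forall j k, slope phi b j.+1 k = y (digit b j k)) ->
  forall t : R, 0 <= t <= 1 -> exists2 N : nat -> nat,
    (forall n, `|(N n)%:R / (b ^ n)%:R - t| <= (b ^ n)%:R^-1) &
    (forall n, variation_sum b q (extend01 (takagi_series phi b alpha)) n t =
       (alpha ^+ q) ^+ n *
         \sum_(0 <= k < N n) digit_series b (alpha * b%:R)^-1 y n k ^+ q).
Proof.
move=> b0 a0 phi1 phi0 q0 slopeE t /andP[t0 t1].
have bn0 n : 0 < (b ^ n)%:R :> R by rewrite ltr0n expn_gt0 b0.
pose T n := Num.truncn (t * b%:R ^+ n).
(* The cap at b ^ n matters only for t = 1: the increment of f beyond 1 is 0. *)
exists (fun n => minn (T n).+1 (b ^ n)) => n.
- have : (T n)%:R <= t * (b ^ n)%:R < (T n).+1%:R.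
    by rewrite natrX truncn_itv// mulr_ge0// exprn_ge0.
  move=> /andP[Tle Tgt].
  rewrite -[X in _ <= X]mul1r ler_pdivlMr// -[X in _ * X]ger0_norm//.
  rewrite -normrM mulrBl divfK ?gt_eqF//.
  case: leqP => Tb; rewrite ler_norml.
    by rewrite -natr1 in Tgt *; apply/andP; split; lra.
  have : (b ^ n)%:R <= t * (b ^ n)%:R.
    by apply: le_trans Tle; rewrite ler_nat.
  have : t * (b ^ n)%:R <= (b ^ n)%:R by rewrite ler_piMl// ltW.
  by move=> ? ?; apply/andP; split; lra.
- rewrite /variation_sum -/(T n).
  rewrite (big_cat_nat _ (geq_minl (T n).+1 (b ^ n)))//=.
  rewrite [X in _ + X]big1_seq ?addr0; last first.
    move=> k; rewrite /= mem_index_iota geq_min => /andP[/orP[/leq_trans H /H|bk _]].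
      by rewrite ltnn.
    have min1 i : (b ^ n <= i)%N -> Num.min (i%:R / b%:R ^+ n) 1 = 1 :> R.
      by move=> bi; rewrite min_r// -natrX ler_pdivlMr// mul1r ler_nat.
    by rewrite /extend01 !min1 ?subrr ?expr0n ?gtn_eqF// leqW.
  rewrite mulr_sumr; apply: eq_big_nat => k /andP[_].
  rewrite leq_min => /andP[_ kb].
  have min1 i : (i <= b ^ n)%N ->
      Num.min (i%:R / b%:R ^+ n) 1 = i%:R / b%:R ^+ n :> R.
    by move=> ib; rewrite min_l// -natrX ler_pdivrMr// mul1r ler_nat.
  rewrite /extend01 !min1 ?(ltnW kb)// (takagi_increment _ _ _ y)//.
  by rewrite exprMn -!exprM mulnC.
Qed.

(** The ratio for the averages is [|c|]: it is at least 1/b because [|alpha| < 1], and below 1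
    because [|alpha|] exceeds 1/b. *)
Lemma variation_limit (R : realType) (b q : nat) (phi : R -> R)
    (y : nat -> R) (alpha B : R) :
  (0 < b)%N -> alpha != 0 -> `|alpha| < 1 -> b%:R^-1 < `|alpha| ->
  alpha ^+ q = Num.sg alpha / b%:R -> (0 < q)%N ->
  periodic phi 1 -> phi 0 = 0 ->
  (forall j k, slope phi b j.+1 k = y (digit b j k)) ->
  (forall u, `|y u| <= B) ->
  exists2 a, moment (b ^ M) (digit_series b (alpha * b%:R)^-1 y M) q
      @[M --> \oo] --> a &
    forall t : R, 0 <= t <= 1 ->
      Num.sg alpha ^+ n * variation_sum b q
        (extend01 (takagi_series phi b alpha)) n t @[n --> \oo] --> t * a.
Proof.
move=> b0 a0 a1 ba aq q0 phi1 phi0 slopeE yB.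
set c := (alpha * b%:R)^-1.
have b0' : 0 < b%:R :> R by rewrite ltr0n.
have ab : 1 < `|alpha| * b%:R by rewrite -ltr_pdivrMr// mul1r.
have cE : `|c| = (`|alpha| * b%:R)^-1 by rewrite normfV normrM (ger0_norm (ltW b0')).
have c1 : `|c| < 1 by rewrite cE invf_lt1// (lt_trans ltr01).
have bc : b%:R^-1 <= `|c|.
  by rewrite cE lef_pV2 ?posrE ?(lt_trans ltr01 ab)// ler_piMl// ltW.
have [C [Cb Cd]] := digit_series_power_bounds _ b q c B y c1 q0 yB.
have [||a aM aN] := cvg_average _ b
    (fun n k => digit_series b c y n k ^+ q) C `|c| b0 _ _ Cb Cd.
- by rewrite bc.
- by move=> M k; rewrite digit_series_mod.
exists a => // t t01.
have [N Nt vE] := variation_sum_takagi _ b q phi y alpha b0 a0 phi1 phi0 q0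
  slopeE t t01.
apply: cvg_trans (aN t N t01 Nt); apply: near_eq_cvg; apply: nearW => n.
(* The power [alpha ^+ q] supplies both the normalisation by [b ^ n] and a second copy of the sign,
   which squares to 1. *)
rewrite vE aq mulrA -exprMn mulrA -expr2 sqr_sg a0 mul1r exprVn natrX.
by rewrite mulrC.
Qed.

(** The logarithmic identity says that |alpha|^q = 1/b. Oddness of [q] restores the sign, and
    [q = 1] would force |alpha| = 1/b. *)
Lemma expr_log_base (R : realType) (b q : nat) (alpha : R) :
  (1 < b)%N -> -1 < alpha < 1 -> b%:R^-1 < `|alpha| ->
  q%:R = - (ln b%:R / ln `|alpha|) -> odd q ->
  alpha ^+ q = Num.sg alpha / b%:R /\ (q != 1)%N.
Proof.
move=> b1 /andP[an1 a1] ba qE q_odd.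
have b0 : 0 < b%:R :> R by rewrite ltr0n (ltn_trans _ b1).
have a0 : 0 < `|alpha| by apply: lt_trans ba; rewrite invr_gt0.
have la : `|alpha| < 1 by rewrite ltr_norml an1.
have lna : ln `|alpha| < 0 by rewrite ln_lt0// a0.
have pow : `|alpha| ^+ q = b%:R^-1.
  apply: ln_inj; rewrite ?posrE ?exprn_gt0 ?invr_gt0//.
  by rewrite lnXn// lnV ?posrE// -(mulr_natl (ln _)) qE; field; rewrite lt_eqF.
split; last by apply: contraTneq ba => q1; rewrite -pow q1 expr1 ltxx.
rewrite {1}[alpha]numEsg exprMn pow; congr (_ / _).
have : alpha != 0 by rewrite -normr_gt0.
rewrite /Num.sg => /negbTE->; case: ifP => _; last by rewrite expr1n.
by rewrite -signr_odd q_odd expr1.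
Qed.

(** * Random digits and the expectation of the power of the series *)

Lemma measurable_nat_comp (d d' : measure_display) (T : measurableType d)
    (T' : measurableType d') (X : T -> nat) (h : nat -> T') :
  measurable_fun setT X -> measurable_fun setT (fun w => h (X w)).
Proof. by move=> mX; apply: (measurableT_comp _ mX) => _ Y mY. Qed.

Lemma measurable_digit_sum (d : measure_display) (T : measurableType d)
    (b : nat) (U : nat -> T -> nat) (M : nat) :
  (forall i, measurable_fun setT (U i)) -> measurable_fun setT (digit_sum b U M).
Proof.
move=> mU; elim: M => [|M IH].
  rewrite (_ : digit_sum b U 0 = cst 0%N); first exact: measurable_cst.
  by apply/funext => w; rewrite /digit_sum big_ord0.
rewrite (_ : digit_sum b U M.+1 =
    fun w => (digit_sum b U M w + U M w * b ^ M)%N); last first.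
  by apply/funext => w; rewrite /digit_sum big_ord_recr.
apply: measurable_fun_addn => //.
exact: (measurable_nat_comp _ _ _ _ (U M) (fun k => k * b ^ M)%N (mU M)).
Qed.

Lemma expectation_finite_range (R : realType) (d : measure_display)
    (T : measurableType d) (P : probability T R) (X : T -> nat) (n : nat)
    (g : nat -> R) :
  measurable_fun setT X -> (forall w, (X w < n)%N) ->
  ('E_P[fun w => g (X w)])%E =
    (\sum_(0 <= k < n) g k * fine (P (X @^-1` [set k])))%:E.
Proof.
move=> mX Xn.
have mXk k : measurable (X @^-1` [set k]).
  by rewrite -[X in measurable X]setTI; apply: mX.
have int_ind k : P.-integrable setT (fun w => (\1_(X @^-1` [set k]) w)%:E).
  exact: integrable_indic.
rewrite unlock.
transitivity (\int[P]_w \sum_(0 <= k < n)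
    ((g k)%:E * (\1_(X @^-1` [set k]) w)%:E))%E.
  apply: eq_integral => w _; rewrite (bigD1_seq (X w)) ?iota_uniq//=; last first.
    by rewrite mem_index_iota Xn.
  rewrite indicE mem_set// mule1 big1 ?adde0// => k kX.
  rewrite indicE memNset ?mule0//= => Xk.
  by rewrite Xk eqxx in kX.
rewrite integral_sum//; last first.
  by move=> k; apply: integrableZl => //; exact: int_ind.
rewrite -sumEFin; apply: eq_bigr => k _.
rewrite (integralZl measurableT (int_ind k)).
by rewrite integral_indic// setIT EFinM fineK// fin_num_measure.
Qed.

Lemma digit_sumS (T : Type) (b : nat) (U : nat -> T -> nat) (M : nat) (w : T) :
  digit_sum b U M.+1 w = (U M w * b ^ M + digit_sum b U M w)%N.
Proof. by rewrite /digit_sum big_ord_recr addnC. Qed.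

Lemma digit_sum_modn (T : Type) (b : nat) (U : nat -> T -> nat) (M n : nat)
    (w : T) :
  (M <= n)%N -> (digit_sum b U n w = digit_sum b U M w %[mod b ^ M])%N.
Proof.
move=> Mn; rewrite -(subnK Mn); elim: (n - M)%N => // i IH.
by rewrite addSn digit_sumS expnD mulnA modnMDl.
Qed.

Lemma digit_sum_digits (T : Type) (b : nat) (U : nat -> T -> nat) (M k : nat)
    (w : T) :
  (forall i, (i < M)%N -> U i w = digit b i k) ->
  digit_sum b U M w = (k %% b ^ M)%N.
Proof.
elim: M => [|M IH] Uk; first by rewrite /digit_sum big_ord0 modn1.
rewrite digit_sumS Uk// IH => [|i iM]; last by rewrite Uk// ltnW.
rewrite [RHS](divn_eq _ (b ^ M)) /digit modn_divl -expnS; congr (_ + _)%N.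
by rewrite modn_dvdm// expnS dvdn_mull.
Qed.

(* The digits may exceed b on a null set, so independence is only used for the
   lower bound; equality follows because the lower bounds already sum to 1. *)
Lemma digit_sum_uniform (R : realType) (d : measure_display)
    (T : measurableType d) (P : probability T R) (b : nat) (U : nat -> T -> nat)
    (M k : nat) :
  (0 < b)%N -> (forall i, measurable_fun setT (U i)) ->
  independent_sequence P U -> (forall i, uniform_below P b (U i)) ->
  (k < b ^ M)%N ->
  fine (P ((fun w => digit_sum b U M w %% b ^ M)%N @^-1` [set k])) =
    (b ^ M)%:R^-1.
Proof.
move=> b0 mU indep unif.
have bM0 : (0 < b ^ M)%N by rewrite expn_gt0 b0.
set X := fun w => (digit_sum b U M w %% b ^ M)%N.
have mX : measurable_fun setT X.
  apply: (measurable_nat_comp _ _ _ _ (digit_sum b U M) (fun k => k %% b ^ M)%N).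
  exact: measurable_digit_sum.
have mXk j : measurable (X @^-1` [set j]).
  by rewrite -[X in measurable X]setTI; apply: mX.
pose p j := fine (P (X @^-1` [set j])).
have p_ge j : (j < b ^ M)%N -> (b ^ M)%:R^-1 <= p j.
  move=> jM; rewrite -lee_fin /p fineK ?fin_num_measure//.
  have mUi i : measurable (U i @^-1` [set digit b i j]).
    by rewrite -[X in measurable X]setTI; apply: mU.
  (* The event that the first [M] random digits are those of [j] has this probability by
     independence, and it is contained in the event [X = j]. *)
  have -> : ((b ^ M)%:R^-1)%:E = P (\bigcap_(i in [set` iota 0 M])
      (U i @^-1` [set digit b i j])) :> \bar R.
    rewrite (indep _ (fun i => [set digit b i j]))// ?iota_uniq//.
    rewrite (eq_bigr (fun=> (b%:R^-1)%:E)) => [|i _]; last first.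
      by rewrite unif// ltn_pmod.
    rewrite prodEFin big_const_seq count_predT size_iota iter_mulr_1.
    by rewrite natrX exprVn.
  apply: le_measure; rewrite ?inE//; first exact: bigcap_measurableType.
  move=> w /= Uw; rewrite /X (digit_sum_digits _ _ _ _ j) ?modn_mod ?modn_small//.
  by move=> i iM; apply: Uw; rewrite /= mem_iota.
have sum_p : \sum_(0 <= j < b ^ M) p j = 1.
  have := expectation_finite_range _ _ _ P X (b ^ M) (fun=> 1) mX
    (fun w => ltn_pmod _ bM0).
  rewrite expectation_cst => -[->].
  by apply: eq_bigr => j _; rewrite mul1r.
move=> kM; apply/eqP; rewrite -subr_eq0; apply/eqP.
(* The excesses over the lower bound are nonnegative and sum to 0, hence all vanish. *)
apply: (@psumr_eq0P _ 'I_(b ^ M) xpredT (fun j => p j - (b ^ M)%:R^-1) _ _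
  (Ordinal kM)) => // [j _|]; first by rewrite subr_ge0 p_ge.
rewrite -(big_mkord xpredT (fun j => p j - (b ^ M)%:R^-1)) sumrB sum_p.
by rewrite sumr_const_nat subn0 -(mulr_natl (_^-1)) mulfV ?subrr// pnatr_eq0 -lt0n.
Qed.

Lemma digit_series_digit_sum (R : realType) (T : Type) (b : nat)
    (U : nat -> T -> nat) (c : R) (y : nat -> R) (M n : nat) (w : T) :
  (0 < b)%N -> (M <= n)%N ->
  digit_series b c y M (digit_sum b U n w) =
    digit_series b c y M (digit_sum b U M w).
Proof.
move=> b0 Mn; rewrite -digit_series_mod// (digit_sum_modn _ _ _ _ _ _ Mn).
by rewrite digit_series_mod.
Qed.

(** Later random digits do not change digit [j], so all terms can be read off the single index
    [digit_sum b U M w]. *)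
Lemma slope_series_partial (R : realType) (T : Type) (phi : R -> R)
    (y : nat -> R) (b : nat) (alpha : R) (U : nat -> T -> nat) (M : nat) (w : T) :
  (0 < b)%N -> (forall j k, slope phi b j.+1 k = y (digit b j k)) ->
  \sum_(1 <= m < M.+1) (alpha * b%:R) ^- m * slope_process phi b U m w =
    digit_series b (alpha * b%:R)^-1 y M (digit_sum b U M w).
Proof.
move=> b0 slopeE; rewrite big_add1 /=; apply: eq_big_nat => j /andP[_ jM].
rewrite exprVn /slope_process slopeE -(@digit_mod b j.+1)//.
by rewrite -(digit_sum_modn _ _ _ _ _ _ jM) digit_mod.
Qed.

Lemma slope_series_power_cvg (R : realType) (T : Type) (phi : R -> R)
    (y : nat -> R) (b q : nat) (alpha B : R) (U : nat -> T -> nat) (w : T) :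
  (0 < b)%N -> (forall j k, slope phi b j.+1 k = y (digit b j k)) ->
  (forall u, `|y u| <= B) -> `|(alpha * b%:R)^-1| < 1 ->
  digit_series b (alpha * b%:R)^-1 y M (digit_sum b U M w) ^+ q @[M --> \oo]
    --> slope_series phi b alpha U w ^+ q.
Proof.
move=> b0 slopeE yB; set c := (alpha * b%:R)^-1 => c1.
pose u M := digit_series b c y M (digit_sum b U M w).
have cu : cvgn u.
  have [C [_ Cd]] := digit_series_power_bounds _ b 1 c B y c1 isT yB.
  have [|M n Mn|a ua _] := geometric_cauchy _ u C `|c|; first by rewrite normr_ge0.
    rewrite /u -(digit_series_digit_sum _ _ _ _ _ _ _ _ _ _ Mn)//.
    exact: (Cd _ _ (digit_sum b U n w) Mn).
  by apply/cvg_ex; exists a.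
suff -> : slope_series phi b alpha U w = limn u.
  apply: (@cvg_comp _ _ _ u (fun x => x ^+ q) _ _ _ cu).
  exact: exprn_continuous.
(* The partial sums stop before [N], so they run one index ahead of [u]. *)
apply/cvg_lim => //; rewrite -(cvg_shiftn 1) /=.
apply: cvg_trans cu; apply: near_eq_cvg; apply: nearW => n.
by rewrite addn1 (slope_series_partial _ _ _ y).
Qed.

(** Dominated convergence with a constant bound: the truncated expectations are exactly the moments
    over a full period. *)
Lemma expectation_slope_series_power (R : realType) (d : measure_display)
    (T : measurableType d) (P : probability T R) (phi : R -> R)
    (y : nat -> R) (b q : nat) (alpha B a : R) (U : nat -> T -> nat) :
  (0 < b)%N -> (forall j k, slope phi b j.+1 k = y (digit b j k)) ->
  (forall u, `|y u| <= B) -> `|(alpha * b%:R)^-1| < 1 -> (0 < q)%N ->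
  (forall i, measurable_fun setT (U i)) ->
  independent_sequence P U -> (forall i, uniform_below P b (U i)) ->
  moment (b ^ M) (digit_series b (alpha * b%:R)^-1 y M) q
    @[M --> \oo] --> a ->
  ('E_P[fun w => (slope_series phi b alpha U w ^+ q)%R])%E = a%:E.
Proof.
move=> b0 slopeE yB; set c := (alpha * b%:R)^-1 => c1 q0 mU indep unif aE.
have [C [Cb _]] := digit_series_power_bounds _ b q c B y c1 q0 yB.
pose u M w := digit_series b c y M (digit_sum b U M w) ^+ q.
have mu M : measurable_fun setT (u M).
  apply: (measurable_nat_comp _ _ _ _ (digit_sum b U M)
    (fun k => digit_series b c y M k ^+ q)).
  exact: measurable_digit_sum.
have Eu M : (\int[P]_w (u M w)%:E)%E =
    (moment (b ^ M) (digit_series b c y M) q)%:E.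
  have bM0 : (0 < b ^ M)%N by rewrite expn_gt0 b0.
  (* Reduction modulo [b ^ M] gives a finite range even where random digits exceed [b]. *)
  have -> : u M = fun w => digit_series b c y M
      (digit_sum b U M w %% b ^ M)%N ^+ q.
    by apply/funext => w; rewrite digit_series_mod.
  have mX : measurable_fun setT (fun w => digit_sum b U M w %% b ^ M)%N.
    apply: (measurable_nat_comp _ _ _ _ (digit_sum b U M)
      (fun k => k %% b ^ M)%N).
    exact: measurable_digit_sum.
  have := expectation_finite_range _ _ _ P _ (b ^ M)
    (fun k => digit_series b c y M k ^+ q) mX (fun w => ltn_pmod _ bM0).
  rewrite unlock => ->; congr EFin; rewrite /moment mulr_suml.
  apply: eq_big_nat => k /andP[_ kM].
  by rewrite digit_sum_uniform.
rewrite unlock.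
have int_cvg : (\int[P]_w (u M w)%:E)%E @[M --> \oo] -->
    (\int[P]_w (slope_series phi b alpha U w ^+ q)%:E)%E.
  apply: (@dominated_cvg _ _ _ P setT measurableT (fun M w => (u M w)%:E)
    _ (cst C%:E)) => //.
  - by move=> M; exact/measurable_EFinP.
  - move=> w _; apply: cvg_EFin; first exact: nearW.
    exact: slope_series_power_cvg.
  - exact: finite_measure_integrable_cst.
  - by move=> M w _; rewrite lee_fin Cb.
apply: (@cvg_unique _ (@ereal_hausdorff R) _ _ _ _ int_cvg).
rewrite (funext Eu).
by apply: cvg_EFin; first exact: nearW.
Qed.

(** * Sign of the limit and the three cases of the theorem *)

(** The bound [e], uniform over even levels, survives in the limit along that subsequence, so
    strictness is kept. *)
Lemma limit_moment_sign (R : realType) (b l : nat) (x z c s a : R) (q : nat) :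
  (0 < l < b)%N -> 0 < x -> 0 < z -> l%:R * x = (b - l)%:R * z ->
  c != 0 -> -1 < c -> s = 1 /\ z < x \/ s = -1 /\ x < z ->
  odd q -> (q != 1)%N ->
  moment (b ^ M) (digit_series b c (two_valued l x z) M) q @[M --> \oo] --> a ->
  0 < Num.sg c * s * a.
Proof.
move=> lb x0 z0 LK c0 c1 sE q_odd q1 aE.
have [e e0 eM] := digit_moment_sign _ b l x z c s q lb x0 z0 LK c0 c1 sE q_odd q1.
apply: lt_le_trans e0 _.
apply: (@cvgr_to_ge _ \oo _ _ (fun M => Num.sg c * s *
  moment (b ^ M.*2.+2) (digit_series b c (two_valued l x z) M.*2.+2) q)).
  apply: cvgM; first exact: cvg_cst.
  apply: (@cvg_comp _ _ _ (fun M => M.*2.+2) (fun M => moment (b ^ M)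
    (digit_series b c (two_valued l x z) M) q) _ \oo _ _ aE).
  by apply/cvgnyPge => A; exists A => // n /= An; lia.
exact: nearW.
Qed.

Lemma cvg_subsequence (T : topologicalType) (u : nat -> T) (s : nat -> nat)
    (L : T) :
  (forall n, (n <= s n)%N) -> u n @[n --> \oo] --> L ->
  u (s n) @[n --> \oo] --> L.
Proof.
move=> sn uL; apply: (@cvg_comp _ _ _ s u _ \oo _ _ uL).
by apply/cvgnyPge => A; exists A => // n /= An; exact: leq_trans (sn n).
Qed.

Theorem theorem3p4 (R : realType) (b l : nat) (phi : R -> R) (alpha : R)
    (q : nat) (d : measure_display) (T : measurableType d)
    (P : probability T R) (U : nat -> {RV P >-> nat})
    (hb : (2 <= b)%N) (hl : (1 <= l <= b - 1)%N)
    (hphi_periodic : periodic phi 1)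
    (hphi_left : forall t : R, 0 <= t <= l%:R / b%:R ->
       phi t = t * (b%:R / (2 * l%:R)))
    (hphi_right : forall t : R, l%:R / b%:R <= t <= 1 ->
       phi t = (1 - t) * (b%:R / (2 * (b%:R - l%:R))))
    (halpha : -1 < alpha < 1) (halphab : b%:R^-1 < `|alpha|)
    (hq : q%:R = - (ln b%:R / ln `|alpha|)) (hqodd : odd q)
    (hUindep : independent_sequence P (fun i => U i : T -> nat))
    (hUunif : forall i, uniform_below P b (U i)) :
  let f := extend01 (takagi_series phi b alpha) in
  let Z := slope_series phi b alpha (fun i => U i : T -> nat) in
  let EZq := ('E_P[fun w => (Z w ^+ q)%R])%E in
  [/\ ~~ odd b -> l%:R = b%:R / 2 :> R ->
        forall t : R, 0 <= t <= 1 ->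
          variation_sum b q f n t @[n --> \oo] --> (0 : R),
      0 < alpha ->
        [/\ signed_variation_exists_along id b q f,
            forall t : R, 0 <= t <= 1 ->
              ((limn (fun n => variation_sum b q f n t))%:E = t%:E * EZq)%E,
            l%:R < b%:R / 2 :> R -> (0 < EZq)%E
          & l%:R > b%:R / 2 :> R -> (EZq < 0)%E]
    & alpha < 0 -> l%:R != b%:R / 2 :> R ->
        [/\ forall t : R, 0 <= t <= 1 ->
              cvgn (fun n => (-1) ^+ n * variation_sum b q f n t) /\
              ((limn (fun n => (-1) ^+ n * variation_sum b q f n t))%:E =
                 t%:E * EZq)%E,
            signed_variation_exists_along (fun n => n.*2) b q f,
            signed_variation_exists_along (fun n => n.*2.+1) b q f
          & ~ signed_variation_exists_along id b q f]].
Proof.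
move=> f Z EZq.
have b0 : (0 < b)%N by lia.
have lb : (0 < l < b)%N by lia.
have [l_gt0 l_ltb] := andP lb.
have b0' : 0 < b%:R :> R by rewrite ltr0n.
have l0' : 0 < l%:R :> R by rewrite ltr0n.
have bl0' : 0 < b%:R - l%:R :> R by rewrite subr_gt0 ltr_nat.
pose x : R := b%:R / (2 * l%:R); pose z : R := b%:R / (2 * (b%:R - l%:R)).
have x0 : 0 < x by rewrite divr_gt0// mulr_gt0.
have z0 : 0 < z by rewrite divr_gt0// mulr_gt0.
have LK : l%:R * x = (b - l)%:R * z.
  by rewrite natrB ?(ltnW l_ltb)// /x /z; field; rewrite !gt_eqF.
pose y := two_valued l x z.
have slopeE j k : slope phi b j.+1 k = y (digit b j k) by exact: slope_tent.
have yB u : `|y u| <= x + z.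
  rewrite /y /two_valued; case: ifP => _; rewrite ?normrN ger0_norm ?ltW//.
    by rewrite ltrDl.
  by rewrite ltrDr.
have phi0 : phi 0 = 0 by rewrite hphi_left ?mul0r// lexx divr_ge0.
have a_gt0 : 0 < `|alpha| by apply: lt_trans halphab; rewrite invr_gt0.
have a0 : alpha != 0 by rewrite -normr_gt0.
have a1 : `|alpha| < 1 by rewrite ltr_norml.
have [aq q1] := expr_log_base _ _ _ _ hb halpha halphab hq hqodd.
have q0 : (0 < q)%N by case: (q) hqodd.
pose c := (alpha * b%:R)^-1.
have c0 : c != 0 by rewrite invr_eq0 mulf_neq0// gt_eqF.
have c1 : `|c| < 1.
  rewrite /c normfV normrM (ger0_norm (ltW b0')) invf_lt1 ?mulr_gt0//.
  by rewrite -ltr_pdivrMr// mul1r.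
have cN1 : -1 < c by move: c1; rewrite ltr_norml => /andP[].
have sgc : Num.sg c = Num.sg alpha.
  by rewrite /c sgrV sgrM (gtr0_sg b0') mulr1.
have [a aM aV] := variation_limit _ b q phi y alpha (x + z) b0 a0 a1 halphab aq
  q0 hphi_periodic phi0 slopeE yB.
have EZqE : EZq = a%:E.
  exact: (expectation_slope_series_power _ _ _ _ _ _ _ _ _ _ _ _ b0 slopeE yB
    c1 q0 _ hUindep hUunif aM).
have sign s : s = 1 /\ z < x \/ s = -1 /\ x < z -> 0 < Num.sg alpha * s * a.
  move=> sE; rewrite -sgc.
  exact: (limit_moment_sign _ b l x z c s a q).
have zx : (z < x) = (l%:R < b%:R / 2 :> R).
  rewrite /z /x ltr_pM2l// ltf_pV2 ?posrE ?mulr_gt0// ltr_pM2l//.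
  by apply/idP/idP => ?; lra.
have xz : (x < z) = (b%:R / 2 < l%:R :> R).
  rewrite /z /x ltr_pM2l// ltf_pV2 ?posrE ?mulr_gt0// ltr_pM2l//.
  by apply/idP/idP => ?; lra.
split.
- move=> _ lE t t01.
  have b2l : b = l.*2.
    apply/eqP; rewrite -(eqr_nat R) -muln2 natrM lE; apply/eqP; lra.
  have xzE : z = x by rewrite /x /z lE; congr (_ / (2 * _)); lra.
  have a_0 : a = 0.
    apply: (cvg_unique _ aM) => //; rewrite /y xzE.
    rewrite (funext (fun M => digit_moment_symmetric _ _ _ M _ _ _ b0 b2l hqodd)).
    exact: cvg_cst.
  (* The factor [Num.sg alpha ^+ n] has modulus 1, so it does not affect convergence to 0 and both
     signs of [alpha] are covered. *)
  have := aV t t01; rewrite a_0 mulr0 => V0; apply/norm_cvg0P.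
  apply: cvg_trans ((norm_cvg0P _).2 V0); apply: near_eq_cvg; apply: nearW => n.
  by rewrite normrM normrX normr_sg a0 expr1n mul1r.
- move=> apos.
  have V t : 0 <= t <= 1 -> variation_sum b q f n t @[n --> \oo] --> t * a.
    move=> t01; have := aV t t01; rewrite (gtr0_sg apos).
    apply: cvg_trans; apply: near_eq_cvg; apply: nearW => n.
    by rewrite expr1n mul1r.
  split.
  + by move=> t t01; apply/cvg_ex; exists (t * a); exact: V.
  + by move=> t t01; rewrite EZqE -EFinM; congr EFin; apply/cvg_lim => //; exact: V.
  + rewrite -zx => zx'; rewrite EZqE lte_fin.
    by have := sign 1 (or_introl (conj erefl zx')); rewrite gtr0_sg// !mul1r.
  + rewrite -xz => xz'; rewrite EZqE lte_fin.
    have := sign (-1) (or_intror (conj erefl xz')).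
    by rewrite gtr0_sg// mul1r mulN1r oppr_gt0.
- move=> aneg lne.
  (* Since [l] differs from b/2, one of [z < x] and [x < z] holds, and [sign] excludes a zero
     limit. *)
  have a_neq0 : a != 0.
    apply/eqP => a_0.
    have [zx'|xz'|xzE] := ltgtP z x.
    + by have := sign 1 (or_introl (conj erefl zx')); rewrite a_0 mulr0 ltxx.
    + by have := sign (-1) (or_intror (conj erefl xz')); rewrite a_0 mulr0 ltxx.
    + by move: lne; rewrite neq_lt -zx -xz xzE ltxx.
  have V t : 0 <= t <= 1 ->
      (-1) ^+ n * variation_sum b q f n t @[n --> \oo] --> t * a.
    by move=> t01; have := aV t t01; rewrite (ltr0_sg aneg).
  have le_double n : (n <= n.*2)%N by rewrite -addnn leq_addr.
  have le_doubleS n : (n <= n.*2.+1)%N by rewrite leqW.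
  have Veven t : 0 <= t <= 1 ->
      variation_sum b q f n.*2 t @[n --> \oo] --> t * a.
    move=> /V/(cvg_subsequence _ _ (fun n => n.*2) _ le_double) H.
    apply: cvg_trans H; apply: near_eq_cvg; apply: nearW => n.
    by rewrite -signr_odd odd_double expr0 mul1r.
  have Vodd t : 0 <= t <= 1 ->
      variation_sum b q f n.*2.+1 t @[n --> \oo] --> - (t * a).
    move=> /V/(cvg_subsequence _ _ (fun n => n.*2.+1) _ le_doubleS)/cvgN H.
    apply: cvg_trans H; apply: near_eq_cvg; apply: nearW => n.
    transitivity (- ((-1) ^+ n.*2.+1 * variation_sum b q f n.*2.+1 t)) => //.
    by rewrite -signr_odd /= odd_double expr1 mulN1r opprK.
  split.
  + move=> t t01; split; first by apply/cvg_ex; exists (t * a); exact: V.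
    by rewrite EZqE -EFinM; congr EFin; apply/cvg_lim => //; exact: V.
  + by move=> t t01; apply/cvg_ex; exists (t * a); exact: Veven.
  + by move=> t t01; apply/cvg_ex; exists (- (t * a)); exact: Vodd.
  + have t01 : 0 <= (1 : R) <= 1 by rewrite ler01 lexx.
    (* At [t = 1] a full limit would equal both [a] (even levels) and [- a] (odd levels), forcing
       [a = 0]. *)
    move=> /(_ 1 t01)/cvg_ex[L vL].
    have L1 : L = 1 * a.
      apply: (cvg_unique _ _ (Veven 1 t01)) => //.
      exact: (cvg_subsequence _ _ (fun n => n.*2) _ le_double vL).
    have L2 : L = - (1 * a).
      apply: (cvg_unique _ _ (Vodd 1 t01)) => //.
      exact: (cvg_subsequence _ _ (fun n => n.*2.+1) _ le_doubleS vL).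
    by move/eqP: a_neq0; apply; lra.
Qed.
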